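(* Let $\lambda>0$ and $\mu>0$ be real numbers and let $M^1_b\subseteq\mathbb R^7$ be the set of all $(z,u,v_0)=(z_1,z_2,z_3,u_1,u_2,u_3,v_0)$ satisfying $$u_3-v_0z_3=0,\quad u_1^2+u_2^2+u_3^2+\lambda v_0^2-\mu=0,\quad z_1^2+z_2^2+z_3^2-1=0,\quad z_1u_1+z_2u_2+z_3u_3=0.$$ Then: (1) These four equations define $M^1_b$ regularly (the Jacobian matrix of the four functions has rank $4$ at every point of $M^1_b$), so $M^1_b$ is a nonsingular $3$-dimensional submanifold of $\mathbb R^7$. (2) The map $f:S^2\times S^1\to M^1_b$, $f(z,(\cos\psi,\sin\psi))=(z,u,v_0)$, given, with $z=(\sin\theta\cos\varphi,\sin\theta\sin\varphi,\cos\theta)$, by $$u_1=-a\cos(\varphi-\psi)\cos^2\theta\cos\varphi-b\sin(\varphi-\psi)\sin\varphi,$$ $$u_2=-a\cos(\varphi-\psi)\cos^2\theta\sin\varphi+b\sin(\varphi-\psi)\cos\varphi,$$ $$u_3=a\cos(\varphi-\psi)\cos\theta\sin\theta,\qquad v_0=a\cos(\varphi-\psi)\sin\theta,$$ where $$a=\sqrt{\frac{\mu}{\lambda\sin^2\theta+\cos^2\theta}},\qquad b=\sqrt{\mu},$$ is well defined and is a diffeomorphism of $S^2\times S^1$ onto $M^1_b$.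
   Context: $S^2\subseteq\mathbb R^3$ is the unit sphere, with spherical angles $\theta\in[0,\pi]$, $\varphi\in[0,2\pi)$, and $S^1\subseteq\mathbb R^2$ is the unit circle. (In the paper $\lambda=(\alpha+\beta)/(1+\beta)$ and $\mu=2\epsilon/(1+\beta)$ for the rolling symmetric elastic sphere with normalized energy $\epsilon>0$; both are positive.) *)

(* Defs.v *)
From HB Require Import structures.
From mathcomp Require Import all_boot all_order all_algebra.
From mathcomp Require Import all_classical all_reals all_analysis.

Set Implicit Arguments.
Unset Strict Implicit.
Unset Printing Implicit Defensive.

Import Order.TTheory GRing.Theory Num.Theory.
Import numFieldNormedType.Exports.

Local Open Scope classical_set_scope.
Local Open Scope ring_scope.

(* Coordinates of a row vector are numbered from 0. *)
Definition row_of_seq (R : realType) (n : nat) (s : seq R) : 'rV[R]_n :=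
  \row_(i < n) s`_i.

Section Smooth.
Variables (R : realType) (V W : normedModType R).

(* C^k on an open set [U]: [f] is C^(k+1) when it is Frechet differentiable on
   [U] and its differential is C^k.  All spaces used here being
   finite-dimensional, the latter means that [x |-> 'd f x v] is C^k for every
   fixed vector [v]. *)
Fixpoint is_Ck (k : nat) (U : set V) (f : V -> W) : Prop :=
  match k with
  | 0 => forall x, U x -> {for x, continuous f}
  | k'.+1 => (forall x, U x -> differentiable f x) /\
             (forall v : V, is_Ck k' U (fun x => 'd f x v))
  end.

Definition is_Cinfty (U : set V) (f : V -> W) : Prop :=
  forall k : nat, is_Ck k U f.

(* Smoothness on an arbitrary subset of a Euclidean space: near each point of
   [A], [f] coincides on [A] with a smooth map on an open set of the ambient
   space. *)
Definition smooth_on (A : set V) (f : V -> W) : Prop :=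
  forall x, A x -> exists (U : set V) (g : V -> W),
    [/\ open U, U x, is_Cinfty U g & forall y, A y -> U y -> g y = f y].

End Smooth.

Definition diffeomorphism (R : realType) (V W : normedModType R)
    (A : set V) (B : set W) (f : V -> W) : Prop :=
  [/\ set_bij A B f, smooth_on A f &
      exists g : W -> V, (forall x, A x -> g (f x) = x) /\ smooth_on B g].

(* [M] is a [d]-dimensional smooth submanifold of R^N: every point of [M] has a
   relatively open neighbourhood in [M] that is diffeomorphic to an open subset
   of R^d. *)
Definition submanifold (R : realType) (N d : nat) (M : set 'rV[R]_N.+1) : Prop :=
  forall p, M p ->
  exists (O : set 'rV[R]_N.+1) (U : set 'rV[R]_d) (h : 'rV[R]_d -> 'rV[R]_N.+1),
    [/\ open O, O p, open U & diffeomorphism U (M `&` O) h].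

(* The norm of ['rV[R]_n] in the library is the sup norm, hence the explicit
   sum of squares. *)
Definition unit_sphere (R : realType) (n : nat) : set 'rV[R]_n.+1 :=
  [set x | \sum_(i < n.+1) x 0 i ^+ 2 = 1].

(* A point (z, u, v0) of R^7 has coordinates
   (z1, z2, z3, u1, u2, u3, v0) = (x 0 0, x 0 1, ..., x 0 6). *)
Definition Mb_eqs (R : realType) (lambda mu : R) (x : 'rV[R]_7) : 'rV[R]_4 :=
  let z1 := x 0 0 in let z2 := x 0 1 in let z3 := x 0 2 in
  let u1 := x 0 3 in let u2 := x 0 4 in let u3 := x 0 5 in
  let v0 := x 0 6 in
  row_of_seq 4
    [:: u3 - v0 * z3;
        u1 ^+ 2 + u2 ^+ 2 + u3 ^+ 2 + lambda * v0 ^+ 2 - mu;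
        z1 ^+ 2 + z2 ^+ 2 + z3 ^+ 2 - 1;
        z1 * u1 + z2 * u2 + z3 * u3].

Definition Mb (R : realType) (lambda mu : R) : set 'rV[R]_7 :=
  [set x | Mb_eqs lambda mu x = 0].

Definition spherical (R : realType) (theta phi : R) : 'rV[R]_3 :=
  row_of_seq 3 [:: sin theta * cos phi; sin theta * sin phi; cos theta].

Definition circular (R : realType) (psi : R) : 'rV[R]_2 :=
  row_of_seq 2 [:: cos psi; sin psi].

Definition f_angles (R : realType) (lambda mu theta phi psi : R) : 'rV[R]_7 :=
  let a := Num.sqrt (mu / (lambda * sin theta ^+ 2 + cos theta ^+ 2)) in
  let b := Num.sqrt mu in
  row_of_seq 7
    [:: sin theta * cos phi;
        sin theta * sin phi;
        cos theta;
        - a * cos (phi - psi) * cos theta ^+ 2 * cos phi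
          - b * sin (phi - psi) * sin phi;
        - a * cos (phi - psi) * cos theta ^+ 2 * sin phi
          + b * sin (phi - psi) * cos phi;
        a * cos (phi - psi) * cos theta * sin theta;
        a * cos (phi - psi) * sin theta].

(* [f] is given by the formula in terms of angles.  At the poles of the sphere
   phi is not determined by z, so the existence of such an [f] is not
   automatic. *)
Definition given_by_angles (R : realType) (lambda mu : R)
    (f : 'rV[R]_3 * 'rV[R]_2 -> 'rV[R]_7) : Prop :=
  forall theta phi psi : R,
    0 <= theta <= pi -> 0 <= phi < 2 * pi ->
    f (spherical theta phi, circular psi) = f_angles lambda mu theta phi psi.

(* Main.v *)
From HB Require Import structures.
Require Import Defs.
From mathcomp Require Import all_boot all_order all_algebra.
From mathcomp Require Import all_classical all_reals all_analysis.
From mathcomp Require Import ring lra.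

Set Implicit Arguments.
Unset Strict Implicit.
Unset Printing Implicit Defensive.

Import Order.TTheory GRing.Theory Num.Theory.
Import numFieldNormedType.Exports.

Local Open Scope classical_set_scope.
Local Open Scope ring_scope.

(* Write b = sqrt mu, w = sqrt (lambda (z1^2 + z2^2) + z3^2) (so that a = b / w)
   and m = (w + lambda) / (1 + w).  On the unit sphere the formula in terms of
   angles, which looks singular at the poles, is the same as
     v0 = b (z1 cos psi + z2 sin psi) / w,   u3 = v0 z3,
     u1 = v0 m z1 - b cos psi,               u2 = v0 m z2 - b sin psi,
   because (b - a) / (b sin^2 theta) = (lambda - 1) / (w (1 + w)) is smooth.
   The last two equations solve for (cos psi, sin psi) as a function of
   (z, u, v0), and this is the smooth inverse.  That both maps take values in
   the right sets follows from the identities m (z1^2 + z2^2) = w - z3^2 and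
   m (w + z3^2) = z3^2 + lambda.  Composing with stereographic projections of
   the two spheres gives the charts of the submanifold. *)

(** * Calculus of C^k maps *)

Section Ck.
Variables (R : realType) (V : normedModType R).

(** The first-order expansion of [f] at [x] is also one of [g], and a differential is unique. *)
Lemma is_diff_near_eq (W : normedModType R) (f g : V -> W) x :
  (\forall y \near x, f y = g y) -> differentiable f x ->
  is_diff x g ('d f x).
Proof.
move=> fg df.
have gfE : g \o shift x = cst (g x) + 'd f x +o_ 0 id.
  apply/eqaddoP => e e0.
  have /eqaddoP/(_ e e0) := diff_locally df.
  have fgx : f x = g x by exact: nbhs_singleton fg.
  have fg0 : \forall h \near 0, f (h + x) = g (h + x).
    move: fg; rewrite (near_shift 0 x); apply: filterS => h /=.
    by rewrite subr0.
  apply: filter_app; near=> h. rewrite /= !fctE -fgx. by rewrite (near fg0 h).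
have dE := diff_unique (diff_continuous df) gfE.
apply: DiffDef => //.
by apply/diff_locallyP; rewrite dE; split => //; exact: diff_continuous.
Unshelve. all: by end_near. Qed.

(** Since [U] is open, equality on [U] is equality near each of its points, so the differentials
    also agree on [U] and the induction goes on with them. *)
Lemma is_Ck_eq (W : normedModType R) k (U : set V) (f g : V -> W) :
  open U -> (forall x, U x -> f x = g x) -> is_Ck k U f -> is_Ck k U g.
Proof.
move=> oU; elim: k f g => [|k IH] f g fg /=.
  move=> fc x Ux; have : f @ x --> f x by exact: fc.
  rewrite /prop_for /continuous_at fg//.
  apply: cvg_trans; apply: near_eq_cvg.
  by near=> y; rewrite /= fg//; near: y; exact: open_nbhs_nbhs.
have nfg x : U x -> \forall y \near x, f y = g y.
  by move=> Ux; near=> y; rewrite fg//; near: y; exact: open_nbhs_nbhs.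
move=> [df cf]; split => [x Ux|v].
  by have := is_diff_near_eq (nfg _ Ux) (df _ Ux) => -[].
apply: IH (cf v) => x Ux.
by have := is_diff_near_eq (nfg _ Ux) (df _ Ux) => -[_ ->].
Unshelve. all: by end_near. Qed.

(** Lets the inductions below work with an explicit formula for the differential that is valid on
    [U] only. *)
Lemma is_CkS (W : normedModType R) k (U : set V) (f : V -> W)
    (df : V -> V -> W) : open U -> (forall x, U x -> is_diff x f (df x)) ->
  (forall v, is_Ck k U (df ^~ v)) -> is_Ck k.+1 U f.
Proof.
move=> oU fd ck /=; split => [x /fd[]//|v].
by apply: is_Ck_eq (ck v) => // x /fd[_ ->].
Qed.

Lemma is_CkW (W : normedModType R) k (U : set V) (f : V -> W) :
  is_Ck k.+1 U f -> is_Ck k U f.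
Proof.
elim: k f => [|k IH] f [df cf].
  by move=> x Ux; apply: differentiable_continuous; exact: df.
by split => // v; exact/IH/cf.
Qed.

Lemma is_Ck_cst (W : normedModType R) k (U : set V) (w : W) :
  is_Ck k U (fun=> w).
Proof.
elim: k w => [|k IH] w /=; first by move=> x _; exact: cvg_cst.
split => [x _|v]; first exact: differentiable_cst.
by rewrite (_ : (fun _ => _) = fun=> 0) //; apply/funext => x; rewrite diff_cst.
Qed.

(** A map that is its own differential has constant directional derivatives. *)
Lemma is_Ck_lin (W : normedModType R) k (U : set V) (f : V -> W) :
  (forall x, is_diff x f f) -> is_Ck k U f.
Proof.
move=> df; case: k => [|k].
  by move=> x _; apply: differentiable_continuous; have [] := df x.
split => [x _|v]; first by have [] := df x.
rewrite (_ : (fun _ => _) = fun=> f v); first exact: is_Ck_cst.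
by apply/funext => x; have [_ ->] := df x.
Qed.

(* Stated separately because destructing [is_Ck k.+1 U f] directly unfolds the
   fixpoint in the second component. *)
Lemma is_CkSD (W : normedModType R) k (U : set V) (f : V -> W) :
  is_Ck k.+1 U f -> (forall x, U x -> differentiable f x) /\
    (forall v, is_Ck k U (fun x => 'd f x v)).
Proof. by []. Qed.

Lemma is_CkD (W : normedModType R) k (U : set V) (f g : V -> W) : open U ->
  is_Ck k U f -> is_Ck k U g -> is_Ck k U (fun x => f x + g x).
Proof.
move=> oU; elim: k f g => [|k IH] f g.
  by move=> cf cg x Ux; apply: cvgD; [exact: cf|exact: cg].
move=> /is_CkSD[df cf] /is_CkSD[dg cg].
apply: (@is_CkS _ _ _ _ (fun x v => 'd f x v + 'd g x v)) => // [x Ux|v].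
  have /differentiableP df' := df _ Ux; have /differentiableP dg' := dg _ Ux.
  exact: is_diffD.
exact: (IH _ _ (cf v) (cg v)).
Qed.

(** The product rule brings back [f] and [g] themselves, so the induction also needs them at the
    lower order, through [is_CkW]. *)
Lemma is_CkM k (U : set V) (f g : V -> R) : open U ->
  is_Ck k U f -> is_Ck k U g -> is_Ck k U (fun x => f x * g x).
Proof.
move=> oU; elim: k f g => [|k IH] f g.
  by move=> cf cg x Ux; apply: cvgM; [exact: cf|exact: cg].
move=> ckf ckg; have [df cf] := is_CkSD ckf; have [dg cg] := is_CkSD ckg.
apply: (@is_CkS _ _ _ _ (fun x v => f x * 'd g x v + g x * 'd f x v)) => //
  [x Ux|v].
  have /differentiableP df' := df _ Ux; have /differentiableP dg' := dg _ Ux.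
  exact: is_diffM.
by apply: is_CkD => //; apply: IH => //; exact: is_CkW.
Qed.

Lemma is_CkN k (U : set V) (f : V -> R) : open U ->
  is_Ck k U f -> is_Ck k U (fun x => - f x).
Proof.
move=> oU cf; apply: (@is_Ck_eq _ _ _ (fun x => -1 * f x)) => //.
  by move=> x _; rewrite mulN1r.
by apply: is_CkM => //; exact: is_Ck_cst.
Qed.

Lemma is_CkX k (U : set V) (f : V -> R) n : open U ->
  is_Ck k U f -> is_Ck k U (fun x => f x ^+ n).
Proof.
move=> oU cf; elim: n => [|n IH]; first exact: is_Ck_cst.
apply: (@is_Ck_eq _ _ _ (fun x => f x * f x ^+ n)) => //.
  by move=> x _; rewrite exprS.
exact: is_CkM.
Qed.

(** The differential of the inverse is a polynomial in the inverse times ['d f], so the induction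
    hypothesis for the inverse itself closes the step; [is_Ck_sqrt] proceeds in the same way. *)
Lemma is_CkV k (U : set V) (f : V -> R) : open U ->
  (forall x, U x -> f x != 0) -> is_Ck k U f -> is_Ck k U (fun x => (f x)^-1).
Proof.
move=> oU f0; elim: k => [|k IH].
  by move=> cf x Ux; apply: cvgV; [exact: f0|exact: cf].
move=> ckf; have [df cf] := is_CkSD ckf.
apply: (@is_CkS _ _ _ _ (fun x v => - ((f x)^-1) ^+ 2 * 'd f x v)) => //
  [x Ux|v].
  split; first exact: differentiableV (df x Ux) (f0 x Ux).
  by rewrite (diffV (df x Ux) (f0 x Ux)) exprVn.
have IHf := IH (is_CkW ckf).
by apply: is_CkM => //; apply: is_CkN => //; exact: is_CkX.
Qed.

Lemma is_diff_sqrt (f : V -> R) x : 0 < f x -> differentiable f x ->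
  is_diff x (fun y => Num.sqrt (f y))
    (fun v => (2 * Num.sqrt (f x))^-1 * 'd f x v).
Proof.
move=> fx0 /differentiableP df.
have [sd se] := is_derive1_sqrt fx0.
have ds : is_diff (f x) (@Num.sqrt R) ( *:%R^~ (2 * Num.sqrt (f x))^-1).
  split; first exact/derivable1_diffP.
  by rewrite deriv1E// derive1E se.
have [dc dcE] := is_diff_comp df ds.
split; first exact: dc.
rewrite [LHS]dcE.
by apply/funext => v; exact: mulrC.
Qed.

Lemma is_Ck_sqrt k (U : set V) (f : V -> R) : open U ->
  (forall x, U x -> 0 < f x) -> is_Ck k U f ->
  is_Ck k U (fun x => Num.sqrt (f x)).
Proof.
move=> oU f0; elim: k => [|k IH].
  move=> cf x Ux; apply: continuous_comp; first exact: cf.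
  exact: sqrt_continuous.
move=> ckf; have [df cf] := is_CkSD ckf.
apply: (@is_CkS _ _ _ _ (fun x v => (2 * Num.sqrt (f x))^-1 * 'd f x v)) => //.
  by move=> x Ux; apply: is_diff_sqrt; [exact: f0|exact: df].
move=> v; apply: is_CkM => //; apply: is_CkV => //.
  by move=> x Ux; rewrite mulf_neq0// sqrtr_eq0 -ltNge f0.
by apply: is_CkM; [by []|exact: is_Ck_cst|exact/IH/is_CkW].
Qed.

Lemma is_CkZl (W : normedModType R) k (U : set V) (f : V -> R) (w : W) :
  open U -> is_Ck k U f -> is_Ck k U (fun x => f x *: w).
Proof.
move=> oU; elim: k f => [|k IH] f.
  by move=> cf x Ux; apply: cvgZr_tmp; exact: cf.
move=> /is_CkSD[df cf].
apply: (@is_CkS _ _ _ _ (fun x v => 'd f x v *: w)) => // [x Ux|v].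
  split; first exact: differentiableZl (df x Ux).
  exact: (diffZl w (df x Ux)).
exact: (IH _ (cf v)).
Qed.

Lemma is_Ck_pair (W1 W2 : normedModType R) k (U : set V) (f : V -> W1)
    (g : V -> W2) : open U ->
  is_Ck k U f -> is_Ck k U g -> is_Ck k U (fun x => (f x, g x)).
Proof.
move=> oU; elim: k f g => [|k IH] f g.
  by move=> cf cg x Ux; apply: cvg_pair; [exact: cf|exact: cg].
move=> /is_CkSD[df cf] /is_CkSD[dg cg].
apply: (@is_CkS _ _ _ _ (fun x v => ('d f x v, 'd g x v))) => // [x Ux|v].
  split; first exact: differentiable_pair (df x Ux) (dg x Ux).
  exact: (diff_pair (df x Ux) (dg x Ux)).
exact: (IH _ _ (cf v) (cg v)).
Qed.

(** Expand [f] in the standard basis; the induction runs over an arbitrary list of indices. *)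
Lemma is_Ck_row k n (U : set V) (f : V -> 'rV[R]_n) : open U ->
  (forall i, is_Ck k U (fun x => f x 0 i)) -> is_Ck k U f.
Proof.
move=> oU ckf.
rewrite (_ : f = fun x => \sum_i f x 0 i *: delta_mx 0 i); last first.
  by apply/funext => x; rewrite -row_sum_delta.
elim: (index_enum _) => [|i s IH].
  rewrite (_ : (fun _ => _) = fun=> 0); first exact: is_Ck_cst.
  by apply/funext => x; rewrite big_nil.
rewrite (_ : (fun _ => _) = fun x => f x 0 i *: delta_mx 0 i +
    \sum_(j <- s) f x 0 j *: delta_mx 0 j).
  by apply: is_CkD => //; exact: is_CkZl.
by apply/funext => x; rewrite big_cons.
Qed.

Lemma is_Ck_row_of_seq k n (U : set V) (s : V -> seq R) : open U ->
  (forall i, (i < n)%N -> is_Ck k U (fun x => (s x)`_i)) ->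
  is_Ck k U (fun x => row_of_seq n (s x)).
Proof.
move=> oU cks; apply: is_Ck_row => // i.
rewrite (_ : (fun _ => _) = fun x => (s x)`_i); first exact: cks.
by apply/funext => x; rewrite mxE.
Qed.

End Ck.

Lemma is_diff_coord (R : realType) n (i : 'I_n) (x : 'rV[R]_n) :
  is_diff x (fun y : 'rV[R]_n => y 0 i) (fun y : 'rV[R]_n => y 0 i).
Proof.
have coordL : linear (fun y : 'rV[R]_n => y 0 i) by move=> a y z; rewrite !mxE.
pose M := GRing.isLinear.Build _ _ _ _ _ coordL.
pose f : {linear 'rV[R]_n -> R} := HB.pack (fun y : 'rV[R]_n => y 0 i) M.
have fc : continuous f by exact: coord_continuous.
split; first exact: differentiable_coord.
exact: (diff_lin x fc).
Qed.

Lemma is_Ck_coord (R : realType) k n (i : 'I_n) (U : set 'rV[R]_n) :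
  is_Ck k U (fun y : 'rV[R]_n => y 0 i).
Proof. by apply: is_Ck_lin => x; exact: is_diff_coord. Qed.

Lemma is_Ck_coord_fst (R : realType) k m n (i : 'I_m)
    (U : set ('rV[R]_m * 'rV[R]_n)) : is_Ck k U (fun y => y.1 0 i).
Proof.
apply: is_Ck_lin => x.
have d1 : is_diff x (@fst 'rV[R]_m 'rV[R]_n) fst.
  have fc : continuous (@fst 'rV[R]_m 'rV[R]_n) by move=> ?; exact: cvg_fst.
  split; first exact: linear_differentiable.
  exact: (diff_lin x fc).
exact: (is_diff_comp d1 (is_diff_coord i x.1)).
Qed.

Lemma is_Ck_coord_snd (R : realType) k m n (i : 'I_n)
    (U : set ('rV[R]_m * 'rV[R]_n)) : is_Ck k U (fun y => y.2 0 i).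
Proof.
apply: is_Ck_lin => x.
have d2 : is_diff x (@snd 'rV[R]_m 'rV[R]_n) snd.
  have fc : continuous (@snd 'rV[R]_m 'rV[R]_n) by move=> ?; exact: cvg_snd.
  split; first exact: linear_differentiable.
  exact: (diff_lin x fc).
exact: (is_diff_comp d2 (is_diff_coord i x.2)).
Qed.

(** * The parametrization and its inverse *)

Section Parametrization.
Variables (R : realType) (lambda mu : R).
Hypotheses (lambda_gt0 : 0 < lambda) (mu_gt0 : 0 < mu).

Let b := Num.sqrt mu.

(* [weight], [slope] and [spin] are w, m and v0 of the header; (c, s) stands for
   (cos psi, sin psi), recovered by [dir1] and [dir2]. *)
Definition weight (z1 z2 z3 : R) : R :=
  Num.sqrt (lambda * (z1 ^+ 2 + z2 ^+ 2) + z3 ^+ 2).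

Definition slope (z1 z2 z3 : R) : R :=
  (weight z1 z2 z3 + lambda) / (1 + weight z1 z2 z3).

Definition spin (z1 z2 z3 c s : R) : R :=
  b * (z1 * c + z2 * s) / weight z1 z2 z3.

Definition param (z1 z2 z3 c s : R) : 'rV[R]_7 :=
  let v := spin z1 z2 z3 c s in
  let m := slope z1 z2 z3 in
  row_of_seq 7
    [:: z1; z2; z3; v * m * z1 - b * c; v * m * z2 - b * s; v * z3; v].

Definition param_map (p : 'rV[R]_3 * 'rV[R]_2) : 'rV[R]_7 :=
  param (p.1 0 0) (p.1 0 1) (p.1 0 2) (p.2 0 0) (p.2 0 1).

Definition dir1 (x : 'rV[R]_7) : R :=
  (x 0 6 * slope (x 0 0) (x 0 1) (x 0 2) * x 0 0 - x 0 3) / b.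

Definition dir2 (x : 'rV[R]_7) : R :=
  (x 0 6 * slope (x 0 0) (x 0 1) (x 0 2) * x 0 1 - x 0 4) / b.

Definition coparam_map (x : 'rV[R]_7) : 'rV[R]_3 * 'rV[R]_2 :=
  (row_of_seq 3 [:: x 0 0; x 0 1; x 0 2], row_of_seq 2 [:: dir1 x; dir2 x]).

(** * Points and equations in coordinates *)

Lemma row7E (x : 'rV[R]_7) :
  x = row_of_seq 7 [:: x 0 0; x 0 1; x 0 2; x 0 3; x 0 4; x 0 5; x 0 6].
Proof.
apply/rowP => i; rewrite mxE.
by case: i => [[|[|[|[|[|[|[|//]]]]]]] i] /=; congr (x 0 _); apply/val_inj.
Qed.

Lemma row3E (x : 'rV[R]_3) : x = row_of_seq 3 [:: x 0 0; x 0 1; x 0 2].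
Proof.
apply/rowP => i; rewrite mxE.
by case: i => [[|[|[|//]]] i] /=; congr (x 0 _); apply/val_inj.
Qed.

Lemma row2E (x : 'rV[R]_2) : x = row_of_seq 2 [:: x 0 0; x 0 1].
Proof.
apply/rowP => i; rewrite mxE.
by case: i => [[|[|//]] i] /=; congr (x 0 _); apply/val_inj.
Qed.

Lemma unit_sphere2E (x : 'rV[R]_3) :
  unit_sphere x <-> x 0 0 ^+ 2 + x 0 1 ^+ 2 + x 0 2 ^+ 2 = 1.
Proof.
rewrite /unit_sphere /= !big_ord_recl big_ord0 addr0 addrA.
have -> : lift ord0 ord0 = 1 :> 'I_3 by apply/val_inj.
by have -> : lift ord0 (lift ord0 ord0) = 2 :> 'I_3 by apply/val_inj.
Qed.

Lemma unit_sphere1E (x : 'rV[R]_2) :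
  unit_sphere x <-> x 0 0 ^+ 2 + x 0 1 ^+ 2 = 1.
Proof.
rewrite /unit_sphere /= !big_ord_recl big_ord0 addr0.
by have -> : lift ord0 ord0 = 1 :> 'I_2 by apply/val_inj.
Qed.

Lemma row_of_seq4_eq0 (y1 y2 y3 y4 : R) :
  row_of_seq 4 [:: y1; y2; y3; y4] = 0 <-> [/\ y1 = 0, y2 = 0, y3 = 0 & y4 = 0].
Proof.
split=> [/rowP y0|[-> -> -> ->]].
  by have := (y0 0, y0 1, y0 2, y0 3); rewrite !mxE /= => -[[[]]].
by apply/rowP => -[[|[|[|[|//]]]] i]; rewrite !mxE.
Qed.

Lemma MbE (x : 'rV[R]_7) : Mb lambda mu x <->
  [/\ x 0 5 = x 0 6 * x 0 2,
      x 0 3 ^+ 2 + x 0 4 ^+ 2 + x 0 5 ^+ 2 + lambda * x 0 6 ^+ 2 = mu,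
      x 0 0 ^+ 2 + x 0 1 ^+ 2 + x 0 2 ^+ 2 = 1 &
      x 0 0 * x 0 3 + x 0 1 * x 0 4 + x 0 2 * x 0 5 = 0].
Proof.
rewrite /Mb /Mb_eqs /= row_of_seq4_eq0.
split=> -[e1 e2 e3 e4]; split => //; try exact: subr0_eq.
- by rewrite e1 subrr.
- by rewrite e2 subrr.
- by rewrite e3 subrr.
Qed.

(** * Identities for the weight and the slope *)

Lemma sqrt_mu_gt0 : 0 < b. Proof. by rewrite sqrtr_gt0. Qed.

Lemma sqr_sqrt_mu : b ^+ 2 = mu. Proof. by rewrite sqr_sqrtr// ltW. Qed.

Lemma weight_ge0 z1 z2 z3 : 0 <= weight z1 z2 z3.
Proof. exact: sqrtr_ge0. Qed.

Lemma sqr_weight z1 z2 z3 :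
  weight z1 z2 z3 ^+ 2 = lambda * (z1 ^+ 2 + z2 ^+ 2) + z3 ^+ 2.
Proof.
rewrite sqr_sqrtr//; apply: addr_ge0; last exact: sqr_ge0.
by apply: mulr_ge0; [exact: ltW|rewrite addr_ge0 ?sqr_ge0].
Qed.

Lemma weight_gt0 z1 z2 z3 : z1 ^+ 2 + z2 ^+ 2 + z3 ^+ 2 = 1 ->
  0 < weight z1 z2 z3.
Proof.
move=> z_unit; rewrite sqrtr_gt0.
have [z3_eq0|z3_neq0] := eqVneq z3 0.
  move: z_unit; rewrite z3_eq0 expr0n/= !addr0 => ->.
  by rewrite mulr1.
rewrite ltr_wpDl ?exprn_even_gt0//.
by apply: mulr_ge0; [exact: ltW|rewrite addr_ge0 ?sqr_ge0].
Qed.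

(** Away from the poles this determines the slope as (w - z3^2) / (z1^2 + z2^2), the quotient that
    the angle formula produces; the definition of [slope] extends it across the poles. After
    clearing 1 + w it reduces to the value of w^2. *)
Lemma slope_rho z1 z2 z3 : z1 ^+ 2 + z2 ^+ 2 + z3 ^+ 2 = 1 ->
  slope z1 z2 z3 * (z1 ^+ 2 + z2 ^+ 2) = weight z1 z2 z3 - z3 ^+ 2.
Proof.
move=> z_unit; rewrite /slope; have := sqr_weight z1 z2 z3.
have := weight_gt0 z_unit; set w := weight _ _ _ => w_gt0 wE.
have w1 : 1 + w != 0 by lra.
apply: (mulIf w1); rewrite mulrAC -mulrA mulrA divfK//.
have -> : (w - z3 ^+ 2) * (1 + w) = w - z3 ^+ 2 - w * z3 ^+ 2 + w ^+ 2 by ring.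
rewrite wE -[X in X - z3 ^+ 2]mulr1 -z_unit; ring.
Qed.

(** The right-hand side is the coefficient of v0^2 in u3^2 + lambda v0^2 when u3 = v0 z3; this is
    how the energy equation uses it. *)
Lemma slope_weight z1 z2 z3 : z1 ^+ 2 + z2 ^+ 2 + z3 ^+ 2 = 1 ->
  slope z1 z2 z3 * (weight z1 z2 z3 + z3 ^+ 2) = z3 ^+ 2 + lambda.
Proof.
move=> z_unit; rewrite /slope; have := sqr_weight z1 z2 z3.
have := weight_gt0 z_unit; set w := weight _ _ _ => w_gt0 wE.
have w1 : 1 + w != 0 by lra.
apply: (mulIf w1); rewrite mulrAC -mulrA mulrA divfK//.
have -> : (w + lambda) * (w + z3 ^+ 2) =
  w ^+ 2 + (w + lambda) * z3 ^+ 2 + w * lambda by ring.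
have -> : (z3 ^+ 2 + lambda) * (1 + w) =
  (w + lambda) * z3 ^+ 2 + w * lambda + z3 ^+ 2 +
  lambda * (1 - z3 ^+ 2) by ring.
by rewrite wE -z_unit; ring.
Qed.

(** * The two maps take values in the right sets and are mutually inverse *)

Lemma param_Mb z1 z2 z3 c s : z1 ^+ 2 + z2 ^+ 2 + z3 ^+ 2 = 1 ->
  c ^+ 2 + s ^+ 2 = 1 -> Mb lambda mu (param z1 z2 z3 c s).
Proof.
move=> z_unit c_unit; apply/MbE; rewrite /param !mxE /=.
have spinE : spin z1 z2 z3 c s * weight z1 z2 z3 = b * (z1 * c + z2 * s).
  by rewrite divfK// gt_eqF// weight_gt0.
move: spinE (slope_rho z_unit) (slope_weight z_unit).
move: (weight _ _ _) (slope _ _ _) (spin _ _ _ _ _) => w m v vE m1 m2.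
split => //.
(* The cross term is - 2 v^2 m w; it cancels v^2 m (w - z3^2) + v^2 m (w + z3^2), and b^2 = mu
   remains. *)
- have -> : (v * m * z1 - b * c) ^+ 2 + (v * m * z2 - b * s) ^+ 2 +
    (v * z3) ^+ 2 + lambda * v ^+ 2 =
    v ^+ 2 * m * (m * (z1 ^+ 2 + z2 ^+ 2)) + v ^+ 2 * (z3 ^+ 2 + lambda)
    - 2 * v * m * (b * (z1 * c + z2 * s)) + b ^+ 2 * (c ^+ 2 + s ^+ 2) by ring.
  by rewrite -vE m1 -m2 c_unit sqr_sqrt_mu; ring.
- have -> : z1 * (v * m * z1 - b * c) + z2 * (v * m * z2 - b * s) +
    z3 * (v * z3) =
    v * (m * (z1 ^+ 2 + z2 ^+ 2)) - b * (z1 * c + z2 * s) + v * z3 ^+ 2 by ring.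
  by rewrite -vE m1; ring.
Qed.

Lemma coparam_mapK (p : 'rV[R]_3 * 'rV[R]_2) : coparam_map (param_map p) = p.
Proof.
case: p => z c; rewrite /coparam_map /dir1 /dir2 /param_map /param !mxE /=.
rewrite [RHS]surjective_pairing/= [in RHS](row3E z) [in RHS](row2E c).
have b_neq0 : b != 0 by rewrite gt_eqF ?sqrt_mu_gt0.
by congr (_, row_of_seq 2 [:: _; _]); field.
Qed.

(** The computation of [param_Mb] read backwards. The first identity puts the recovered direction on
    the circle; the second says that its [spin] is the given v0. *)
Lemma coparam_map_dir (x : 'rV[R]_7) : Mb lambda mu x ->
  dir1 x ^+ 2 + dir2 x ^+ 2 = 1 /\
  b * (x 0 0 * dir1 x + x 0 1 * dir2 x) =
    x 0 6 * weight (x 0 0) (x 0 1) (x 0 2).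
Proof.
move=> /MbE[e1 e2 e3 e4].
have b_neq0 : b != 0 by rewrite gt_eqF ?sqrt_mu_gt0.
have mu_neq0 : mu != 0 by rewrite gt_eqF.
have d1 : b * dir1 x = x 0 6 * slope (x 0 0) (x 0 1) (x 0 2) * x 0 0 - x 0 3.
  by rewrite mulrC divfK.
have d2 : b * dir2 x = x 0 6 * slope (x 0 0) (x 0 1) (x 0 2) * x 0 1 - x 0 4.
  by rewrite mulrC divfK.
move: d1 d2 e1 e2 e4 (slope_rho e3) (slope_weight e3).
move: (weight _ _ _) (slope _ _ _) (dir1 x) (dir2 x) => w m c s d1 d2.
move: (x 0 0) (x 0 1) (x 0 2) (x 0 3) (x 0 4) (x 0 5) (x 0 6) d1 d2 e3 =>
  z1 z2 z3 u1 u2 u3 v d1 d2 e3 e1 e2 e4 m1 m2.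
have zu : z1 * u1 + z2 * u2 = - (v * z3 ^+ 2).
  by apply/eqP; rewrite -addr_eq0 -e4 e1; apply/eqP; ring.
split; last first.
  have -> : b * (z1 * c + z2 * s) = z1 * (b * c) + z2 * (b * s) by ring.
  rewrite d1 d2.
  have -> : z1 * (v * m * z1 - u1) + z2 * (v * m * z2 - u2) =
    v * (m * (z1 ^+ 2 + z2 ^+ 2)) - (z1 * u1 + z2 * u2) by ring.
  by rewrite zu m1; ring.
(* Multiplying by mu = b^2 clears the denominators of [dir1] and [dir2]. *)
apply: (mulfI mu_neq0); rewrite mulr1 -{1}sqr_sqrt_mu.
have -> : b ^+ 2 * (c ^+ 2 + s ^+ 2) = (b * c) ^+ 2 + (b * s) ^+ 2 by ring.
rewrite d1 d2.
have -> : (v * m * z1 - u1) ^+ 2 + (v * m * z2 - u2) ^+ 2 =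
  v ^+ 2 * m * (m * (z1 ^+ 2 + z2 ^+ 2)) - 2 * v * m * (z1 * u1 + z2 * u2) +
  (u1 ^+ 2 + u2 ^+ 2 + u3 ^+ 2 + lambda * v ^+ 2) - u3 ^+ 2 - lambda * v ^+ 2
  by ring.
rewrite e2 zu m1 e1.
have -> : lambda * v ^+ 2 = v ^+ 2 * (z3 ^+ 2 + lambda) - v ^+ 2 * z3 ^+ 2.
  by ring.
by rewrite -m2; ring.
Qed.

Lemma param_mapK (x : 'rV[R]_7) : Mb lambda mu x ->
  param_map (coparam_map x) = x.
Proof.
move=> Mx; have [_ bE] := coparam_map_dir Mx.
have /MbE[e1 _ e3 _] := Mx.
have b_neq0 : b != 0 by rewrite gt_eqF ?sqrt_mu_gt0.
rewrite /param_map /param !mxE /= /spin bE mulfK; last first.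
  by rewrite gt_eqF// weight_gt0.
rewrite [RHS]row7E e1 /dir1 /dir2.
by congr (row_of_seq 7 [:: _; _; _; _; _; _; _]); field.
Qed.

Lemma param_map_Mb p : (@unit_sphere R 2 `*` @unit_sphere R 1) p ->
  Mb lambda mu (param_map p).
Proof. by move=> [/unit_sphere2E ? /unit_sphere1E ?]; exact: param_Mb. Qed.

Lemma coparam_map_sphere x : Mb lambda mu x ->
  (@unit_sphere R 2 `*` @unit_sphere R 1) (coparam_map x).
Proof.
move=> Mx; have [d1 _] := coparam_map_dir Mx; have /MbE[_ _ e3 _] := Mx.
by split; [apply/unit_sphere2E|apply/unit_sphere1E]; rewrite !mxE.
Qed.

(** Here a = b / w, and [slope_rho] reads m sin^2 theta = w - cos^2 theta. The term with w becomes b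
    cos(phi - psi) times cos phi or sin phi, and subtracting b cos psi or b sin psi leaves the
    sin(phi - psi) term. *)
Lemma f_anglesE theta phi psi :
  f_angles lambda mu theta phi psi =
  param_map (spherical theta phi, circular psi).
Proof.
have phi1 := cos2Dsin2 phi; have psi1 := cos2Dsin2 psi.
have theta1 := cos2Dsin2 theta.
rewrite /param_map /param !mxE /=.
have rhoE : (sin theta * cos phi) ^+ 2 + (sin theta * sin phi) ^+ 2 =
    sin theta ^+ 2 by rewrite !exprMn -mulrDr phi1 mulr1.
have z_unit : (sin theta * cos phi) ^+ 2 + (sin theta * sin phi) ^+ 2 +
    cos theta ^+ 2 = 1 by rewrite rhoE addrC.
have w_gt0 := weight_gt0 z_unit.
have := slope_rho z_unit; rewrite /f_angles rhoE.
have -> : Num.sqrt (mu / (lambda * sin theta ^+ 2 + cos theta ^+ 2)) =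
    b / weight (sin theta * cos phi) (sin theta * sin phi) (cos theta).
  have D_ge0 : 0 <= lambda * sin theta ^+ 2 + cos theta ^+ 2.
    by rewrite -rhoE -sqr_weight sqr_ge0.
  by rewrite (sqrtrM _ (ltW mu_gt0)) (sqrtrV D_ge0) -rhoE.
rewrite /spin cosB sinB -/b; move: w_gt0.
move: (weight _ _ _) (slope _ _ _) => w m w_gt0 mE.
have w_neq0 : w != 0 by rewrite gt_eqF.
have spinE : b * (sin theta * cos phi * cos psi + sin theta * sin phi * sin psi)
    / w = b / w * (cos phi * cos psi + sin phi * sin psi) * sin theta by ring.
congr (row_of_seq 7 [:: _; _; _; _; _; _; _]); rewrite spinE.
- have -> : b / w * (cos phi * cos psi + sin phi * sin psi) * sin theta * m *
    (sin theta * cos phi) =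
    b / w * (cos phi * cos psi + sin phi * sin psi) * cos phi *
    (m * sin theta ^+ 2) by ring.
  (* Inserting cos^2 phi + sin^2 phi makes the addition formula for psi = phi - (phi - psi) a
     rational identity within reach of [field]. *)
  have -> : b * cos psi = b * ((cos phi ^+ 2 + sin phi ^+ 2) * cos psi).
    by rewrite phi1 mul1r.
  by rewrite mE; field.
- have -> : b / w * (cos phi * cos psi + sin phi * sin psi) * sin theta * m *
    (sin theta * sin phi) =
    b / w * (cos phi * cos psi + sin phi * sin psi) * sin phi *
    (m * sin theta ^+ 2) by ring.
  have -> : b * sin psi = b * ((cos phi ^+ 2 + sin phi ^+ 2) * sin psi).
    by rewrite phi1 mul1r.
  by rewrite mE; field.
- by ring.
- by [].
Qed.

End Parametrization.

(** * Open conditions, smooth maps on subsets and diffeomorphisms *)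

Lemma open_gt0 (R : realType) (V : normedModType R) (U : set V) (f : V -> R) :
  open U -> is_Ck 0 U f -> open [set x | U x /\ 0 < f x].
Proof.
move=> oU cf; rewrite openE => x [Ux fx_gt0]; rewrite /interior.
have fc : f @ x --> f x by exact: cf.
near=> y; split; near: y; first exact: open_nbhs_nbhs.
exact: (cvgr_gt _ fc).
Unshelve. all: by end_near. Qed.

Lemma is_Ck_subset (R : realType) (V W : normedModType R) k (U U' : set V)
    (f : V -> W) : U `<=` U' -> is_Ck k U' f -> is_Ck k U f.
Proof.
move=> UU'; elim: k f => [|k IH] f; first by move=> cf x /UU'; exact: cf.
move=> /is_CkSD[df cf]; split => [x /UU'|v]; first exact: df.
exact: (IH _ (cf v)).
Qed.

Lemma diffeomorphism_inverse (R : realType) (V W : normedModType R)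
    (A : set V) (B : set W) (f : V -> W) (g : W -> V) :
  (forall x, A x -> B (f x)) -> (forall y, B y -> A (g y)) ->
  (forall x, A x -> g (f x) = x) -> (forall y, B y -> f (g y) = y) ->
  smooth_on A f -> smooth_on B g -> diffeomorphism A B f.
Proof.
move=> AB BA gK fK sf sg; split => //; last by exists g.
split => //.
- by move=> x y /set_mem Ax /set_mem Ay fxy; rewrite -(gK x)// -(gK y)// fxy.
- by move=> y By; exists (g y); [exact: BA|exact: fK].
Qed.

Lemma smooth_on_eq (R : realType) (V W : normedModType R) (A : set V)
    (f g : V -> W) : (forall x, A x -> f x = g x) ->
  smooth_on A f -> smooth_on A g.
Proof.
move=> fg sf x Ax; have [U [h [oU Ux sh hf]]] := sf x Ax.
by exists U, h; split => // y Ay Uy; rewrite hf// fg.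
Qed.

Lemma smooth_on_open (R : realType) (V W : normedModType R) (A U : set V)
    (f : V -> W) : open U -> A `<=` U -> is_Cinfty U f -> smooth_on A f.
Proof. by move=> oU AU sf x Ax; exists U, f; split => //; exact: AU. Qed.

Lemma diffeomorphism_eq (R : realType) (V W : normedModType R)
    (A : set V) (B : set W) (f g : V -> W) : (forall x, A x -> f x = g x) ->
  diffeomorphism A B f -> diffeomorphism A B g.
Proof.
move=> fg [fbij sf [h [hK sh]]]; split.
- by apply: eq_set_bijRL fbij => x /set_mem /fg.
- exact: smooth_on_eq fg sf.
- by exists h; split => // x Ax; rewrite -fg// hK.
Qed.

Ltac solve_Ck := repeat first
  [ by [] | apply: is_Ck_cst | apply: is_Ck_coord | apply: is_Ck_coord_fst
  | apply: is_Ck_coord_snd | apply: is_CkV | apply: is_CkX | apply: is_CkN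
  | apply: is_CkD | apply: is_CkM | apply: is_Ck_sqrt].

(** * Smoothness and charts *)

Section Smoothness.
Variables (R : realType) (lambda mu : R).
Hypotheses (lambda_gt0 : 0 < lambda) (mu_gt0 : 0 < mu).

Section Param.
Variables (V : normedModType R) (k : nat) (U : set V).
Variables (z1 z2 z3 c s v : V -> R).
Hypotheses (oU : open U) (ck1 : is_Ck k U z1) (ck2 : is_Ck k U z2)
  (ck3 : is_Ck k U z3) (ckc : is_Ck k U c) (cks : is_Ck k U s).
Hypothesis D_gt0 : forall x, U x ->
  0 < lambda * (z1 x ^+ 2 + z2 x ^+ 2) + z3 x ^+ 2.

Lemma is_Ck_weight : is_Ck k U (fun x => weight lambda (z1 x) (z2 x) (z3 x)).
Proof. by rewrite /weight; solve_Ck. Qed.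

Lemma is_Ck_slope : is_Ck k U (fun x => slope lambda (z1 x) (z2 x) (z3 x)).
Proof.
have ckw := is_Ck_weight.
rewrite /slope; solve_Ck => x Ux.
by rewrite gt_eqF// ltr_pwDl// weight_ge0.
Qed.

(** The coordinates are arbitrary C^k functions, so that this covers both [param_map] and its
    composite with [chart] without a chain rule for C^k maps. *)
Lemma is_Ck_param :
  is_Ck k U (fun x => param lambda mu (z1 x) (z2 x) (z3 x) (c x) (s x)).
Proof.
have ckw := is_Ck_weight; have ckm := is_Ck_slope.
have ckv : is_Ck k U (fun x => spin lambda mu (z1 x) (z2 x) (z3 x) (c x) (s x)).
  rewrite /spin; solve_Ck => x Ux.
  by rewrite gt_eqF// sqrtr_gt0 D_gt0.
apply: is_Ck_row_of_seq => // i _.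
by case: i => [|[|[|[|[|[|[|i]]]]]]] /=; solve_Ck.
Qed.

End Param.

Let radicand (x : 'rV[R]_7) : R :=
  lambda * (x 0 0 ^+ 2 + x 0 1 ^+ 2) + x 0 2 ^+ 2.

Lemma open_radicand_gt0 : open [set x | 0 < radicand x].
Proof.
rewrite (_ : [set x | _] = [set x | setT x /\ 0 < radicand x]); last first.
  by apply/seteqP; split => x /=; [|case].
by apply: open_gt0; [exact: openT|rewrite /radicand; solve_Ck; exact: openT].
Qed.

Lemma Mb_radicand_gt0 x : Mb lambda mu x -> 0 < radicand x.
Proof. by move=> /MbE[_ _ /(weight_gt0 lambda_gt0)]; rewrite sqrtr_gt0. Qed.

Lemma is_Ck_dir1 k : is_Ck k [set x | 0 < radicand x] (dir1 lambda mu).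
Proof.
have oD := open_radicand_gt0.
have ckm : is_Ck k [set x | 0 < radicand x]
    (fun x => slope lambda (x 0 0) (x 0 1) (x 0 2)).
  by apply: is_Ck_slope => //; exact: is_Ck_coord.
rewrite /dir1; solve_Ck.
Qed.

Lemma is_Ck_dir2 k : is_Ck k [set x | 0 < radicand x] (dir2 lambda mu).
Proof.
have oD := open_radicand_gt0.
have ckm : is_Ck k [set x | 0 < radicand x]
    (fun x => slope lambda (x 0 0) (x 0 1) (x 0 2)).
  by apply: is_Ck_slope => //; exact: is_Ck_coord.
rewrite /dir2; solve_Ck.
Qed.

(** The formula itself is smooth on the open set z != 0 of the ambient space, which is where the
    radicand is positive. *)
Lemma smooth_coparam_map : smooth_on (Mb lambda mu) (coparam_map lambda mu).
Proof.
have oD := open_radicand_gt0.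
apply: (smooth_on_open oD) => [x|k]; first exact: Mb_radicand_gt0.
have ck1 := is_Ck_dir1 k; have ck2 := is_Ck_dir2 k.
apply: is_Ck_pair => //; apply: is_Ck_row_of_seq => // i _.
- by case: i => [|[|[|i]]] /=; solve_Ck.
- by case: i => [|[|i]] /=; solve_Ck.
Qed.

Lemma smooth_param_map :
  smooth_on (@unit_sphere R 2 `*` @unit_sphere R 1) (param_map lambda mu).
Proof.
pose D (p : 'rV[R]_3 * 'rV[R]_2) : R :=
  lambda * (p.1 0 0 ^+ 2 + p.1 0 1 ^+ 2) + p.1 0 2 ^+ 2.
have oD : open [set p | setT p /\ 0 < D p].
  by apply: open_gt0; [exact: openT|rewrite /D; solve_Ck; exact: openT].
apply: (smooth_on_open oD) => [p [/unit_sphere2E p1 _]|k].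
  by split => //; have := weight_gt0 lambda_gt0 p1; rewrite sqrtr_gt0.
apply: is_Ck_param => //; solve_Ck.
by move=> p [].
Qed.

Lemma param_map_diffeomorphism :
  diffeomorphism (@unit_sphere R 2 `*` @unit_sphere R 1) (Mb lambda mu)
    (param_map lambda mu).
Proof.
apply: (@diffeomorphism_inverse _ _ _ _ _ _ (coparam_map lambda mu)).
- by move=> p; exact: param_map_Mb.
- by move=> x; exact: coparam_map_sphere.
- by move=> p _; exact: coparam_mapK.
- by move=> x; exact: param_mapK.
- exact: smooth_param_map.
- exact: smooth_coparam_map.
Qed.

Section Chart.
Variables (sigma tau : R).
Hypotheses (sigma2 : sigma ^+ 2 = 1) (tau2 : tau ^+ 2 = 1).

(* Inverses of the stereographic projections of S^2 and S^1 from the points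
   (0, 0, -sigma) and (-tau, 0). *)
Definition chart (t : 'rV[R]_3) : 'rV[R]_3 * 'rV[R]_2 :=
  let q := 1 + t 0 0 ^+ 2 + t 0 1 ^+ 2 in
  let r := 1 + t 0 2 ^+ 2 in
  (row_of_seq 3 [:: 2 * t 0 0 / q; 2 * t 0 1 / q;
                    sigma * (1 - t 0 0 ^+ 2 - t 0 1 ^+ 2) / q],
   row_of_seq 2 [:: tau * (1 - t 0 2 ^+ 2) / r; 2 * t 0 2 / r]).

Definition cochart (p : 'rV[R]_3 * 'rV[R]_2) : 'rV[R]_3 :=
  row_of_seq 3 [:: p.1 0 0 / (1 + sigma * p.1 0 2);
                   p.1 0 1 / (1 + sigma * p.1 0 2);
                   p.2 0 1 / (1 + tau * p.2 0 0)].

Let q_gt0 (t : 'rV[R]_3) : 0 < 1 + t 0 0 ^+ 2 + t 0 1 ^+ 2.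
Proof. by rewrite -addrA ltr_pwDl// addr_ge0 ?sqr_ge0. Qed.

Let r_gt0 (t : 'rV[R]_3) : 0 < 1 + t 0 2 ^+ 2.
Proof. by rewrite ltr_pwDl// sqr_ge0. Qed.

Lemma chart_sphere t : (@unit_sphere R 2 `*` @unit_sphere R 1) (chart t).
Proof.
have q0 : 1 + t 0 0 ^+ 2 + t 0 1 ^+ 2 != 0 by rewrite gt_eqF.
have r0 : 1 + t 0 2 ^+ 2 != 0 by rewrite gt_eqF.
split; [apply/unit_sphere2E|apply/unit_sphere1E]; rewrite !mxE /=.
  by rewrite !expr_div_n !exprMn sigma2; field.
by rewrite !expr_div_n !exprMn tau2; field.
Qed.

(** The denominator in [cochart] along the chart: its value serves to invert the chart, its
    positivity to place the image in [chart_domain]. *)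
Lemma chart_denom1 t :
  1 + sigma * (chart t).1 0 2 = 2 / (1 + t 0 0 ^+ 2 + t 0 1 ^+ 2).
Proof.
have q0 : 1 + t 0 0 ^+ 2 + t 0 1 ^+ 2 != 0 by rewrite gt_eqF.
by rewrite !mxE /= !mulrA -expr2 sigma2; field.
Qed.

Lemma chart_denom2 t :
  1 + tau * (chart t).2 0 0 = 2 / (1 + t 0 2 ^+ 2).
Proof.
have r0 : 1 + t 0 2 ^+ 2 != 0 by rewrite gt_eqF.
by rewrite !mxE /= !mulrA -expr2 tau2; field.
Qed.

Lemma chartK t : cochart (chart t) = t.
Proof.
have q0 : 1 + t 0 0 ^+ 2 + t 0 1 ^+ 2 != 0 by rewrite gt_eqF.
have r0 : 1 + t 0 2 ^+ 2 != 0 by rewrite gt_eqF.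
rewrite /cochart chart_denom1 chart_denom2 [RHS]row3E !mxE /=.
by congr (row_of_seq 3 [:: _; _; _]); field.
Qed.

Lemma cochartK p : (@unit_sphere R 2 `*` @unit_sphere R 1) p ->
  0 < 1 + sigma * p.1 0 2 -> 0 < 1 + tau * p.2 0 0 ->
  chart (cochart p) = p.
Proof.
case: p => z c [/unit_sphere2E /= z_unit /unit_sphere1E /= c_unit].
move=> d1_gt0 d2_gt0.
rewrite /chart /cochart !mxE /= [in RHS](row3E z) [in RHS](row2E c).
move: z_unit c_unit d1_gt0 d2_gt0.
move: (z 0 0) (z 0 1) (z 0 2) (c 0 0) (c 0 1) => z1 z2 z3 c1 c2.
move=> z_unit c_unit d1_gt0 d2_gt0.
(* On the sphere z1^2 + z2^2 = (1 - sigma z3)(1 + sigma z3), because sigma^2 = 1. *)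
have qE : 1 + (z1 / (1 + sigma * z3)) ^+ 2 + (z2 / (1 + sigma * z3)) ^+ 2 =
    2 / (1 + sigma * z3).
  have -> : 1 + (z1 / (1 + sigma * z3)) ^+ 2 + (z2 / (1 + sigma * z3)) ^+ 2 =
    (1 + 2 * sigma * z3 + sigma ^+ 2 * z3 ^+ 2 + z1 ^+ 2 + z2 ^+ 2) /
      (1 + sigma * z3) ^+ 2 by field; rewrite gt_eqF.
  have -> : z1 ^+ 2 = 1 - z2 ^+ 2 - z3 ^+ 2 by lra.
  by rewrite sigma2; field; rewrite gt_eqF.
have rE : 1 + (c2 / (1 + tau * c1)) ^+ 2 = 2 / (1 + tau * c1).
  have -> : 1 + (c2 / (1 + tau * c1)) ^+ 2 =
    (1 + 2 * tau * c1 + tau ^+ 2 * c1 ^+ 2 + c2 ^+ 2) / (1 + tau * c1) ^+ 2.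
    by field; rewrite gt_eqF.
  have -> : c2 ^+ 2 = 1 - c1 ^+ 2 by lra.
  by rewrite tau2; field; rewrite gt_eqF.
have d1_neq0 : 1 + sigma * z3 != 0 by rewrite gt_eqF.
have d2_neq0 : 1 + tau * c1 != 0 by rewrite gt_eqF.
have qE' : 1 - (z1 / (1 + sigma * z3)) ^+ 2 - (z2 / (1 + sigma * z3)) ^+ 2 =
    2 - 2 / (1 + sigma * z3) by rewrite -qE; ring.
have rE' : 1 - (c2 / (1 + tau * c1)) ^+ 2 = 2 - 2 / (1 + tau * c1).
  by rewrite -rE; ring.
rewrite qE qE' rE rE'.
congr (row_of_seq 3 [:: _; _; _], row_of_seq 2 [:: _; _]).
- by field.
- by field.
- by transitivity (sigma ^+ 2 * z3); [field|rewrite sigma2 mul1r].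
- by transitivity (tau ^+ 2 * c1); [field|rewrite tau2 mul1r].
- by field.
Qed.

(** On [Mb] the last two conditions exclude the centres of the two stereographic projections. The
    radicand condition comes first because [dir1] is known to be continuous only there. *)
Definition chart_domain : set 'rV[R]_7 :=
  [set x | (0 < radicand x /\ 0 < 1 + sigma * x 0 2) /\
           0 < 1 + tau * dir1 lambda mu x].

Lemma open_chart_domain : open chart_domain.
Proof.
have oD := open_radicand_gt0.
have oD2 : open [set x : 'rV[R]_7 | 0 < radicand x /\ 0 < 1 + sigma * x 0 2].
  by apply: (open_gt0 oD); solve_Ck.
apply: (open_gt0 oD2).
have ckd : is_Ck 0 [set x : 'rV[R]_7 | 0 < radicand x /\ 0 < 1 + sigma * x 0 2]
    (dir1 lambda mu).
  by apply: is_Ck_subset (is_Ck_dir1 0) => x [].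
by solve_Ck.
Qed.

Lemma chart_diffeomorphism :
  diffeomorphism [set: 'rV[R]_3] (Mb lambda mu `&` chart_domain)
    (param_map lambda mu \o chart).
Proof.
have oD := open_chart_domain.
apply: (@diffeomorphism_inverse _ _ _ _ _ _
  (cochart \o coparam_map lambda mu)) => //=.
- move=> t _; have st := chart_sphere t.
  have Mt : Mb lambda mu (param_map lambda mu (chart t)) by exact: param_map_Mb.
  split => //.
  (* Two coordinates of [coparam_mapK] identify z3 and [dir1] of the image point with those of
     [chart t]. *)
  have := congr1 fst (coparam_mapK lambda mu_gt0 (chart t)).
  have := congr1 snd (coparam_mapK lambda mu_gt0 (chart t)).
  move=> /rowP/(_ 0) d1E /rowP/(_ 2) z3E.
  rewrite mxE /= in d1E; rewrite mxE /= in z3E.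
  split; [split; first exact: Mb_radicand_gt0|].
    by rewrite z3E chart_denom1 divr_gt0.
  by rewrite d1E chart_denom2 divr_gt0.
- by move=> t _; rewrite coparam_mapK// chartK.
- move=> x [Mx [[_ xs] xt]]; rewrite cochartK ?param_mapK//.
  + exact: coparam_map_sphere.
  + by rewrite mxE.
  + by rewrite mxE.
- apply: (smooth_on_open openT) => // k.
  have oT := @openT 'rV[R]_3.
  have ckq : is_Ck k setT (fun t : 'rV[R]_3 => 1 + t 0 0 ^+ 2 + t 0 1 ^+ 2).
    by solve_Ck.
  have ckr : is_Ck k setT (fun t : 'rV[R]_3 => 1 + t 0 2 ^+ 2) by solve_Ck.
  have q0 (t : 'rV[R]_3) : setT t -> 1 + t 0 0 ^+ 2 + t 0 1 ^+ 2 != 0.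
    by rewrite gt_eqF.
  have r0 (t : 'rV[R]_3) : setT t -> 1 + t 0 2 ^+ 2 != 0 by rewrite gt_eqF.
  pose z1 (t : 'rV[R]_3) := 2 * t 0 0 / (1 + t 0 0 ^+ 2 + t 0 1 ^+ 2).
  pose z2 (t : 'rV[R]_3) := 2 * t 0 1 / (1 + t 0 0 ^+ 2 + t 0 1 ^+ 2).
  pose z3 (t : 'rV[R]_3) := sigma * (1 - t 0 0 ^+ 2 - t 0 1 ^+ 2) /
    (1 + t 0 0 ^+ 2 + t 0 1 ^+ 2).
  pose c (t : 'rV[R]_3) := tau * (1 - t 0 2 ^+ 2) / (1 + t 0 2 ^+ 2).
  pose s (t : 'rV[R]_3) := 2 * t 0 2 / (1 + t 0 2 ^+ 2).
  rewrite (_ : _ \o _ =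
    fun t => param lambda mu (z1 t) (z2 t) (z3 t) (c t) (s t)); last first.
    by apply/funext => t; rewrite /= /param_map !mxE.
  apply: is_Ck_param; rewrite ?/z1 ?/z2 ?/z3 ?/c ?/s; try by solve_Ck.
  move=> t _; have [/unit_sphere2E + _] := chart_sphere t.
  by rewrite !mxE /= => /(weight_gt0 lambda_gt0); rewrite sqrtr_gt0.
- apply: (smooth_on_open oD) => [x []//|k].
  have ck1 : is_Ck k chart_domain (dir1 lambda mu).
    by apply: is_Ck_subset (is_Ck_dir1 k) => x [[]].
  have ck2 : is_Ck k chart_domain (dir2 lambda mu).
    by apply: is_Ck_subset (is_Ck_dir2 k) => x [[]].
  rewrite (_ : _ \o _ = fun x : 'rV[R]_7 => row_of_seq 3
    [:: x 0 0 / (1 + sigma * x 0 2); x 0 1 / (1 + sigma * x 0 2);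
        dir2 lambda mu x / (1 + tau * dir1 lambda mu x)]); last first.
    by apply/funext => x; rewrite /= /cochart !mxE.
  apply: is_Ck_row_of_seq => // i _.
  by case: i => [|[|[|i]]] /=; solve_Ck => x [[_ ?] ?]; rewrite gt_eqF.
Qed.

End Chart.

End Smoothness.

(** * Existence of angles on the circle and on the sphere *)

Lemma circle_angle (R : realType) (c s : R) : c ^+ 2 + s ^+ 2 = 1 ->
  exists2 psi, 0 <= psi < 2 * pi & c = cos psi /\ s = sin psi.
Proof.
move=> cs1; have c_itv : -1 <= c <= 1 by nra.
have s2E : s ^+ 2 = 1 - c ^+ 2 by rewrite -cs1 addrC addKr.
have pi0 := pi_gt0 R.
have [s_ge0|s_lt0] := leP 0 s.
  exists (acos c).
    rewrite acos_ge0//=; apply: (le_lt_trans (acos_lepi c_itv)); lra.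
  by rewrite acosK// sin_acos// -s2E sqrtr_sqr ger0_norm.
(* For s < 0 the angle is 2 pi - acos c; c < 1 gives acos c > 0, hence the strict upper bound. *)
have c_lt1 : -1 <= c < 1.
  by case/andP: c_itv => -> c_le1; rewrite lt_neqAle c_le1 andbT; nra.
have := acos_gt0 c_lt1; have := acos_lepi c_itv => acos_le acos_gt.
exists (2 * pi - acos c); first by apply/andP; split; lra.
have -> : 2 * pi - acos c = - acos c + pi *+ 2 by rewrite mulr_natl addrC.
rewrite cosD2pi sinD2pi cosN sinN acosK// sin_acos// -s2E sqrtr_sqr ltr0_norm//.
by rewrite opprK.
Qed.

Lemma sphere_angles (R : realType) (z : 'rV[R]_3) : unit_sphere z ->
  exists theta phi, [/\ 0 <= theta <= pi, 0 <= phi < 2 * pi &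
    z = spherical theta phi].
Proof.
move=> /unit_sphere2E z_unit.
have z3_itv : -1 <= z 0 2 <= 1 by nra.
have pi0 := pi_gt0 R.
have z3E := acosK z3_itv; set theta := acos (z 0 2) in z3E.
have theta_itv : 0 <= theta <= pi by rewrite acos_ge0// acos_lepi.
have rhoE : z 0 0 ^+ 2 + z 0 1 ^+ 2 = sin theta ^+ 2.
  by rewrite sin2cos2 z3E -z_unit addrK.
exists theta.
have [st0|st0] := eqVneq (sin theta) 0.
  (* At a pole every phi gives the same point; 0 is chosen. *)
  exists 0; split => //; first by rewrite lexx/= mulr_gt0.
  rewrite st0 expr0n/= in rhoE.
  have [z10 z20] : z 0 0 = 0 /\ z 0 1 = 0 by split; nra.
  by rewrite [LHS]row3E /spherical st0 z10 z20 !mul0r z3E.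
have [|phi phi_itv [c1 s1]] :=
  @circle_angle R (z 0 0 / sin theta) (z 0 1 / sin theta).
  by rewrite !expr_div_n -mulrDl rhoE divff// expf_neq0.
exists phi; split => //.
by rewrite [LHS]row3E /spherical -c1 -s1 z3E ![sin theta * _]mulrC !divfK.
Qed.

(** * Regularity of the equations *)

Section Equations.
Variables (R : realType) (lambda mu : R).
Hypotheses (lambda_gt0 : 0 < lambda) (mu_gt0 : 0 < mu).

Lemma differentiable_Mb_eqs x : differentiable (Mb_eqs lambda mu) x.
Proof.
have oT := @openT 'rV[R]_7.
have ck k : is_Ck k setT (Mb_eqs lambda mu).
  apply: is_Ck_row_of_seq => // i _.
  by case: i => [|[|[|[|i]]]] /=; solve_Ck.
by have [d _] := ck 1%N; exact: d.
Qed.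

Lemma diff_Mb_eqs (x w : 'rV[R]_7) : 'd (Mb_eqs lambda mu) x w =
  row_of_seq 4
    [:: w 0 5 - (x 0 6 * w 0 2 + x 0 2 * w 0 6);
        2 * (x 0 3 * w 0 3 + x 0 4 * w 0 4 + x 0 5 * w 0 5 +
             lambda * x 0 6 * w 0 6);
        2 * (x 0 0 * w 0 0 + x 0 1 * w 0 1 + x 0 2 * w 0 2);
        x 0 0 * w 0 3 + x 0 3 * w 0 0 + (x 0 1 * w 0 4 + x 0 4 * w 0 1) +
        (x 0 2 * w 0 5 + x 0 5 * w 0 2)].
Proof.
have c i := is_diff_coord i x.
have diffE (f : 'rV[R]_7 -> R) df : is_diff x f df -> 'd f x w = df w.
  by move=> [_ ->].
have dM := differentiableP (differentiable_Mb_eqs x).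
have sq i : is_diff x (fun y : 'rV[R]_7 => y 0 i ^+ 2)
    (fun w => x 0 i * w 0 i + x 0 i * w 0 i) := is_diffM (c i) (c i).
have mul i j : is_diff x (fun y : 'rV[R]_7 => y 0 i * y 0 j)
    (fun w => x 0 i * w 0 j + x 0 j * w 0 i) := is_diffM (c i) (c j).
apply/rowP => i.
(* By the chain rule, a coordinate of the differential is the differential of that coordinate. *)
have [_ /(congr1 (@^~ w))/= <-] := is_diff_comp dM (is_diff_coord i _).
rewrite mxE; case: i => [[|[|[|[|//]]]] i] /=.
- rewrite (_ : _ \o _ = fun y : 'rV[R]_7 => y 0 5 - y 0 6 * y 0 2); last first.
    by apply/funext => y; rewrite /= mxE.
  exact: (diffE _ _ (is_diffB (c 5) (mul 6 2))).
- rewrite (_ : _ \o _ = fun y : 'rV[R]_7 => y 0 3 ^+ 2 + y 0 4 ^+ 2 +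
    y 0 5 ^+ 2 + lambda * y 0 6 ^+ 2 - mu); last first.
    by apply/funext => y; rewrite /= mxE.
  (* The shape given by the sum and product rules; the final [- 0] comes from the constant [mu]. *)
  rewrite (diffE _ (fun w => x 0 3 * w 0 3 + x 0 3 * w 0 3 +
    (x 0 4 * w 0 4 + x 0 4 * w 0 4) + (x 0 5 * w 0 5 + x 0 5 * w 0 5) +
    lambda * (x 0 6 * w 0 6 + x 0 6 * w 0 6) - 0)).
  by ring.
- rewrite (_ : _ \o _ = fun y : 'rV[R]_7 => y 0 0 ^+ 2 + y 0 1 ^+ 2 +
    y 0 2 ^+ 2 - 1); last first.
    by apply/funext => y; rewrite /= mxE.
  rewrite (diffE _ (fun w => x 0 0 * w 0 0 + x 0 0 * w 0 0 +
    (x 0 1 * w 0 1 + x 0 1 * w 0 1) + (x 0 2 * w 0 2 + x 0 2 * w 0 2) - 0)).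
  by ring.
- rewrite (_ : _ \o _ = fun y : 'rV[R]_7 => y 0 0 * y 0 3 + y 0 1 * y 0 4 +
    y 0 2 * y 0 5); last first.
    by apply/funext => y; rewrite /= mxE.
  exact: (diffE _ _ (is_diffD (is_diffD (mul 0 3) (mul 1 4)) (mul 2 5))).
Qed.

(** The four differentials are linearly independent: a relation with coefficients [v], evaluated in
    suitable directions, loses its coefficients one by one. *)
Lemma rank_jacobian_Mb_eqs x : Mb lambda mu x ->
  \rank ('J (Mb_eqs lambda mu) x) = 4%N.
Proof.
move=> /MbE[e1 e2 e3 e4]; apply/eqP; rewrite -mxrank_tr.
apply: inj_row_free => v vJ.
have vw (w : 'rV[R]_7) : 'd (Mb_eqs lambda mu) x w *m v^T = 0.
  rewrite -(mul_rV_lin1 ('d (Mb_eqs lambda mu) x)) -mulmxA.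
  by rewrite -[_ *m v^T]trmxK trmx_mul trmxK vJ trmx0 mulmx0.
have {vw}E w1 w2 w3 w4 w5 w6 w7 :
    v 0 0 * (w6 - (x 0 6 * w3 + x 0 2 * w7)) +
    v 0 1 * (2 * (x 0 3 * w4 + x 0 4 * w5 + x 0 5 * w6 + lambda * x 0 6 * w7)) +
    v 0 2 * (2 * (x 0 0 * w1 + x 0 1 * w2 + x 0 2 * w3)) +
    v 0 3 * (x 0 0 * w4 + x 0 3 * w1 + (x 0 1 * w5 + x 0 4 * w2) +
      (x 0 2 * w6 + x 0 5 * w3)) = 0.
  have /rowP/(_ 0) := vw (row_of_seq 7 [:: w1; w2; w3; w4; w5; w6; w7]).
  rewrite diff_Mb_eqs !mxE !big_ord_recl big_ord0 !mxE /= => E.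
  rewrite -[RHS]E addr0 !addrA.
  have -> : lift ord0 ord0 = 1 :> 'I_4 by apply/val_inj.
  have -> : lift ord0 (lift ord0 ord0) = 2 :> 'I_4 by apply/val_inj.
  have -> : lift ord0 (lift ord0 (lift ord0 ord0)) = 3 :> 'I_4 by apply/val_inj.
  by ring.
(* Pair the relation with the direction (0, u, v0): since u3 = v0 z3, only
   2 mu (v 0 1) remains. *)
have v1 : v 0 1 = 0.
  have := E 0 0 0 (x 0 3) (x 0 4) (x 0 5) (x 0 6).
  have -> : lambda * x 0 6 * x 0 6 =
    mu - (x 0 3 ^+ 2 + x 0 4 ^+ 2 + x 0 5 ^+ 2) by rewrite -e2; ring.
  have -> : x 0 0 * x 0 3 = - (x 0 1 * x 0 4 + x 0 2 * x 0 5) by lra.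
  rewrite e1 => h; have : v 0 1 * mu = 0 by lra.
  by move/eqP; rewrite mulf_eq0 (gt_eqF mu_gt0) orbF => /eqP.
rewrite v1 in E.
(* The v0-direction gives only a product, as z3 may vanish, but this frees the direction (0, z, 0)
   from [v 0 0] and leaves |z|^2 [v 0 3]. Then the u3-direction isolates [v 0 0], and (z, 0, 0)
   isolates [v 0 2]. *)
have v0z : v 0 0 * x 0 2 = 0 by have := E 0 0 0 0 0 0 1; lra.
have v3 : v 0 3 = 0.
  have := E 0 0 0 (x 0 0) (x 0 1) (x 0 2) 0.
  rewrite !mulr0 !addr0 !mul0r subr0 v0z !add0r => h.
  by rewrite -[v 0 3]mulr1 -e3 -h; ring.
rewrite v3 in E.
have v0 : v 0 0 = 0 by have := E 0 0 0 0 0 1 0; lra.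
rewrite v0 in E.
have v2 : v 0 2 = 0.
  have := E (x 0 0) (x 0 1) (x 0 2) 0 0 0 0.
  rewrite -!expr2 e3; lra.
apply/rowP => -[[|[|[|[|//]]]] i]; rewrite mxE.
- by rewrite -[RHS]v0; congr (v 0 _); apply/val_inj.
- by rewrite -[RHS]v1; congr (v 0 _); apply/val_inj.
- by rewrite -[RHS]v2; congr (v 0 _); apply/val_inj.
- by rewrite -[RHS]v3; congr (v 0 _); apply/val_inj.
Qed.

Lemma submanifold_Mb : submanifold 3 (Mb lambda mu).
Proof.
(* Taking e as the sign of y selects, among the four charts, one whose domain contains the point. *)
have sign (y : R) : exists2 e : R, e ^+ 2 = 1 & 0 < 1 + e * y.
  have [y_ge0|y_lt0] := leP 0 y.
    by exists 1; [rewrite expr1n|rewrite mul1r ltr_pwDl].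
  by exists (-1); [rewrite sqrrN expr1n|rewrite mulN1r; lra].
move=> x Mx.
have [sigma s2 xs] := sign (x 0 2).
have [tau t2 xt] := sign (dir1 lambda mu x).
exists (chart_domain lambda mu sigma tau), setT.
exists (param_map lambda mu \o chart sigma tau).
split.
- exact: open_chart_domain.
- by split => //; split => //; exact: (Mb_radicand_gt0 lambda_gt0 Mx).
- exact: openT.
- exact: chart_diffeomorphism.
Qed.

End Equations.

Theorem mainTheorem3 (R : realType) (lambda mu : R)
    (hlambda : 0 < lambda) (hmu : 0 < mu) :
  ((forall x : 'rV[R]_7, Mb lambda mu x ->
      differentiable (Mb_eqs lambda mu) x /\
      \rank ('J (Mb_eqs lambda mu) x) = 4%N) /\
   submanifold 3 (Mb lambda mu)) /\
  ((exists f : 'rV[R]_3 * 'rV[R]_2 -> 'rV[R]_7, given_by_angles lambda mu f) /\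
   (forall f : 'rV[R]_3 * 'rV[R]_2 -> 'rV[R]_7, given_by_angles lambda mu f ->
      diffeomorphism (@unit_sphere R 2 `*` @unit_sphere R 1) (Mb lambda mu) f)).
Proof.
split; split.
- move=> x Mx; split; first exact: differentiable_Mb_eqs.
  exact: rank_jacobian_Mb_eqs.
- exact: submanifold_Mb.
- exists (param_map lambda mu) => theta phi psi _ _.
  by rewrite f_anglesE.
(* Every point of the product has angles, so the formula forces [f] to agree there with
   [param_map]. *)
- move=> f fE; apply: diffeomorphism_eq (param_map_diffeomorphism hlambda hmu).
  move=> [z c] [/= /sphere_angles[theta [phi [theta_itv phi_itv ->]]]].
  move=> /unit_sphere1E /circle_angle[psi _ [c1 s1]].
  have -> : c = circular psi by rewrite [LHS]row2E c1 s1.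
  by rewrite fE// f_anglesE.
Qed.
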